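(* A (non-oriented) graph is a Burling graph if and only if it is a derived graph. That is, a graph $H$ is isomorphic to an induced subgraph of some graph $G_k$ of the Burling sequence if and only if $H$ is isomorphic to the underlying graph of an induced subgraph of the oriented graph fully derived from some Burling tree.
   Context: Trees: in a rooted tree with root $r$, every vertex $v\neq r$ has a parent $p(v)$ (its neighbour on the path to $r$); a branch is a path $v_1v_2\dots v_k$ with $v_i$ the parent of $v_{i+1}$ for all $i<k$ (it starts at $v_1$). A Burling tree is a 4-tuple $(T,r,\lambda,c)$ where $T$ is a rooted tree with root $r$; $\lambda$ assigns to each non-leaf vertex $v$ one of its children, called the last-born of $v$; and $c$ is a function on $V(T)$ such that if $v\neq r$ is not a last-born then $c(v)$ is the vertex set of a (possibly empty) branch of $T$ starting at the last-born of $p(v)$, while $c(v)=\varnothing$ if $v$ is a last-born or the root. The oriented graph fully derived from $(T,r,\lambda,c)$ has vertex set $V(T)$ and an arc $uv$ iff $v\in c(u)$. An oriented graph is derived from a Burling tree if it is an induced subgraph of the oriented graph fully derived from it; a non-oriented graph is a derived graph if it is the underlying graph of such an oriented graph, for some Burling tree. Burling sequence: for a graph $G$ and a set $\mathcal S$ of stable sets of $G$, define $\mathrm{next}(G,\mathcal S)=(G',\mathcal S')$ as follows. $G'$ consists of a copy of $G$; for each $S\in\mathcal S$ a new disjoint copy $G_S$ of $G$, in which $\mathcal S_S$ denotes the copy of $\mathcal S$; and for each $S\in\mathcal S$ and $Q\in\mathcal S_S$ a new vertex $v_{S,Q}$ adjacent exactly to the vertices of $Q$. $\mathcal S'$ is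 the set of all stable sets $S\cup Q$ and $S\cup\{v_{S,Q}\}$ for $S\in\mathcal S$ (in the first copy of $G$) and $Q\in\mathcal S_S$. Start with $G_1=K_1$, $\mathcal S_1=\{V(G_1)\}$ and set $(G_{k+1},\mathcal S_{k+1})=\mathrm{next}(G_k,\mathcal S_k)$. A Burling graph is a graph isomorphic to an induced subgraph of some $G_k$. *)

(* Defs.v *)
From HB Require Import structures.
From mathcomp Require Import all_boot.

Set Implicit Arguments.
Unset Strict Implicit.
Unset Printing Implicit Defensive.

Record sgraph := SGraph {
  vertex :> finType;
  adj : rel vertex;
  adj_sym : symmetric adj;
  adj_irr : irreflexive adj }.

Definition induced (V : finType) (e : rel V) (A : {set V}) :
  rel {x : V | x \in A} := fun x y => e (val x) (val y).
Arguments induced {V} e A _ _.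

Definition isomorphic (V W : finType) (e : rel V) (f : rel W) :=
  exists2 g : V -> W, bijective g & forall x y, f (g x) (g y) = e x y.

Definition stable (V : finType) (e : rel V) (A : {set V}) :=
  [forall x in A, forall y in A, ~~ e x y].

Lemma stableP (V : finType) (e : rel V) (A : {set V}) :
  reflect {in A &, forall x y, ~~ e x y} (stable e A).
Proof.
apply: (iffP forall_inP) => [h x y xA yA | h x xA].
  exact: (forall_inP (h x xA)).
by apply/forall_inP => y yA; apply: h.
Qed.

Record stgraph := STGraph {
  graph_of :> sgraph;
  family : {set {set graph_of}};
  family_stable : forall S, S \in family -> stable (@adj graph_of) S }.

Section Next.

Variable P : stgraph.

Definition member := {S : {set P} | S \in family P}.

(* The first summand is the first copy of G, the second one is the disjoint
   union of the copies G_S, the third one consists of the vertices v_{S,Q},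
   where Q in S_S is identified with the set of which it is the copy. *)
Definition next_vertex : finType := (P + member * P + member * member)%type.

Definition base (x : P) : next_vertex := inl (inl x).
Definition copy (S : member) (x : P) : next_vertex := inl (inr (S, x)).
Definition new (S Q : member) : next_vertex := inr (S, Q).

Definition next_adj : rel next_vertex := fun u v =>
  match u, v with
  | inl (inl x), inl (inl y) => adj x y
  | inl (inr (X, x)), inl (inr (Y, y)) => (X == Y) && adj x y
  | inr (X, Q), inl (inr (Y, x)) => (X == Y) && (x \in val Q)
  | inl (inr (Y, x)), inr (X, Q) => (X == Y) && (x \in val Q)
  | _, _ => false
  end.

Lemma next_adj_sym : symmetric next_adj.
Proof.
move=> [[x|[X x]]|[X Q]] [[y|[Y y]]|[Y Q']] //=; first exact: adj_sym.
by rewrite eq_sym adj_sym.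
Qed.

Lemma next_adj_irr : irreflexive next_adj.
Proof. by move=> [[x|[X x]]|[X Q]] //=; rewrite adj_irr ?andbF. Qed.

Definition next_graph := SGraph next_adj_sym next_adj_irr.

Definition union_old (S Q : member) : {set next_graph} :=
  base @: val S :|: copy S @: val Q.

Definition union_new (S Q : member) : {set next_graph} :=
  base @: val S :|: [set new S Q].

Definition next_family : {set {set next_graph}} :=
  [set union_old S Q | S in [set: member], Q in [set: member]] :|:
  [set union_new S Q | S in [set: member], Q in [set: member]].

Lemma next_family_stable S : S \in next_family -> stable (@adj next_graph) S.
Proof.
have stb (A : member) x y : x \in val A -> y \in val A -> ~~ adj x y.
  by apply/stableP; apply: family_stable; apply: (valP A).
rewrite inE => /orP[] /imset2P[A B _ _ ->]; apply/stableP => u v;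
  rewrite !inE => /orP[].
- move=> /imsetP[x xA ->] /orP[] /imsetP[y yA ->] //=; exact: stb xA yA.
- move=> /imsetP[x xA ->] /orP[] /imsetP[y yA ->] //=.
  by rewrite negb_and (stb _ _ _ xA yA) orbT.
- by move=> /imsetP[x xA ->] /orP[/imsetP[y yA ->]|/eqP->] //=; apply: stb xA yA.
- by move=> /eqP-> /orP[/imsetP[y yA ->]|/eqP->].
Qed.

Definition next := STGraph next_family_stable.

End Next.

Definition K1 : sgraph :=
  @SGraph unit (fun _ _ => false) (fun _ _ => erefl) (fun _ => erefl).

Lemma K1_stable (S : {set K1}) : S \in [set [set: K1]] -> stable (@adj K1) S.
Proof. by move=> _; apply/stableP. Qed.

(* The sequence starts at index 1; the value at index 0 is irrelevant. *)
Definition burling (k : nat) : stgraph := iter k.-1 next (STGraph K1_stable).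

Definition burling_graph (H : sgraph) :=
  exists2 k, 1 <= k &
    exists A : {set burling k}, isomorphic (@adj H) (induced (@adj (burling k)) A).

Definition is_tree (G : sgraph) :=
  (forall x y : G, connect (@adj G) x y) /\
  (forall s : seq G, ucycle (@adj G) s -> size s <= 2).

Section RootedTree.

Variables (T : sgraph) (r : T).

(* [s], the vertices following [v], describes a path of T from v to r. *)
Definition root_path (v : T) (s : seq T) :=
  [/\ path (@adj T) v s, uniq (v :: s) & last v s = r].

Definition parent (u v : T) := exists s, root_path v (u :: s).

Definition branch (s : seq T) :=
  forall x0 i, i.+1 < size s -> parent (nth x0 s i) (nth x0 s i.+1).

(* The empty sequence encodes the empty branch. *)
Definition branch_from (w : T) (s : seq T) := branch s /\ head w s = w.

End RootedTree.

(* [lastborn v] is [None] exactly when v is a leaf, i.e. has no child. *)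
Record burling_tree := BurlingTree {
  tree :> sgraph;
  troot : tree;
  lastborn : tree -> option tree;
  choosef : tree -> {set tree};
  tree_is_tree : is_tree tree;
  lastborn_child : forall v w, lastborn v = Some w -> parent troot v w;
  lastborn_nonleaf : forall v w, parent troot v w -> lastborn v <> None;
  choose_root : choosef troot = set0;
  choose_lastborn : forall v w, lastborn v = Some w -> choosef w = set0;
  choose_branch : forall u v w, parent troot u v -> lastborn u = Some w ->
    v <> w ->
    exists2 s, branch_from troot w s & choosef v = [set x in s] }.

Definition full_arc (B : burling_tree) : rel B := fun u v => v \in choosef u.

Definition underlying (V : finType) (e : rel V) : rel V :=
  fun x y => e x y || e y x.

Definition derived_graph (H : sgraph) :=
  exists (B : burling_tree) (A : {set B}),
    isomorphic (@adj H) (underlying (induced (@full_arc B) A)).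

(* Main.v *)
From mathcomp Require Import all_boot.
Require Import Defs.

(* A Burling graph is derived: every G_k is the graph fully derived from a
   Burling tree T_k on the same vertices, whose root-to-leaf branches are exactly
   the members of S_k.  T_{k+1} is T_k where below the leaf ending the branch S
   one hangs a copy of T_k, its root being the last-born, and one leaf v_{S,Q}
   for each Q, with c(v_{S,Q}) = Q.

   Conversely, one embeds every subtree of a Burling tree into some G_k in such a
   way that each branch starting at the top of the subtree is the trace of a
   member of S_k.  A subtree is built by hanging under x the subtrees of its
   children one by one, the last-born first: if X is what has been obtained so
   far and v is the next child, then {x} with c(v) is a branch of X, and v can be
   realised by some v_{S,Q} where Q has that trace. *)

Set Implicit Arguments.
Unset Strict Implicit.
Unset Printing Implicit Defensive.

(** * Rooted trees as parent functions *)

Section ParentFunction.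

Variables (V : finType) (p : V -> V) (r : V).

(** The root is a fixed point, which makes [p] total; since every orbit reaches [r], there is no
    other cycle. *)
Definition rooted := p r = r /\ forall v, fconnect p v r.

Definition anc u v := fconnect p v u.

(** The test [v != r] discards the loop of [p] at the root. *)
Definition child u v := (v != r) && (p v == u).

Lemma anc_refl v : anc v v.
Proof. exact: connect0. Qed.

Lemma anc_trans u v w : anc u v -> anc v w -> anc u w.
Proof. by move=> uv vw; apply: connect_trans vw uv. Qed.

Lemma anc_parent v : anc (p v) v.
Proof. exact: fconnect1. Qed.

Lemma ancE u v : anc u v = (u == v) || anc u (p v).
Proof.
apply/idP/orP => [/iter_findex|[/eqP->|]]; last 2 first.
- exact: anc_refl.
- by move=> uv; apply: anc_trans uv (anc_parent v).
case: (findex p v u) => [<-|n]; first by left.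
by rewrite iterSr => <-; right; apply: fconnect_iter.
Qed.

Hypothesis rp : rooted.

Lemma anc_root v : anc r v.
Proof. exact: rp.2. Qed.

(** Induction from the root downwards, on the number of iterations of [p] needed to reach [r]. *)
Lemma rooted_ind (P : V -> Prop) :
  P r -> (forall v, v != r -> P (p v) -> P v) -> forall v, P v.
Proof.
move=> Pr Pp v; have /iter_findex := anc_root v.
move: (findex p v r) => n; elim: n v => [v /= -> //|n IHn v].
rewrite iterSr => /IHn Ppv.
by have [-> //|/Pp] := eqVneq v r; apply.
Qed.

Lemma anc_rootE v : anc v r = (v == r).
Proof.
apply/idP/eqP => [/iter_findex <-|->]; last exact: anc_refl.
by elim: findex => //= n ->; exact: rp.1.
Qed.

(** If [v] were an ancestor of its own parent, then [p v] would be one of [p (p v)], and so on up to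
    the root. *)
Lemma anc_parentF v : v != r -> anc v (p v) = false.
Proof.
elim/rooted_ind: v => [|v vr IHv _]; first by rewrite eqxx.
apply/negP => vpv; have [pvr|pvr] := eqVneq (p v) r.
  by move: vpv; rewrite pvr anc_rootE (negPf vr).
have /negP[] := negbT (IHv pvr).
move: vpv; rewrite ancE => /predU1P[vpv|]; first by rewrite -!vpv anc_refl.
by apply: anc_trans; apply: anc_parent.
Qed.

Lemma anc_antisym u v : anc u v -> anc v u -> u = v.
Proof.
elim/rooted_ind: v u => [u|v vr IHv u]; first by rewrite anc_rootE => /eqP.
rewrite ancE => /predU1P[// | upv] vu.
have /negP[] := negbT (anc_parentF vr).
by rewrite -(IHv u) //; apply: anc_trans vu; apply: anc_parent.
Qed.

Lemma anc_total u v w : anc u w -> anc v w -> anc u v || anc v u.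
Proof.
elim/rooted_ind: w => [|w _ IHw].
  by rewrite !anc_rootE => /eqP-> /eqP->; rewrite anc_refl.
rewrite [anc u w]ancE [anc v w]ancE => /predU1P[->|uw] /predU1P[->|vw].
- by rewrite anc_refl.
- by rewrite (anc_trans vw (anc_parent w)) orbT.
- by rewrite (anc_trans uw (anc_parent w)).
- exact: IHw.
Qed.

Lemma child_anc x u v : child x v -> anc u v = (u == v) || anc u x.
Proof. by case/andP=> _ /eqP <-; exact: ancE. Qed.

Lemma child_ancF x v : child x v -> anc v x = false.
Proof. by case/andP=> vr /eqP <-; exact: anc_parentF. Qed.

(** Two ancestors of [w] are comparable, and distinct siblings are not. *)
Lemma siblings_eq x u v w : child x u -> child x v -> anc u w -> anc v w -> u = v.
Proof.
move=> xu xv uw vw; have /orP[] := anc_total uw vw.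
  by rewrite (child_anc _ xv) (child_ancF xu) orbF => /eqP.
by rewrite (child_anc _ xu) (child_ancF xv) orbF => /eqP.
Qed.

(** Branches are intervals of the ancestor order. This allows working with sets
    [[set y | anc w y && anc y z]] instead of sequences. *)
Lemma mem_child_path w s y :
  path child w s -> (y \in w :: s) = anc w y && anc y (last w s).
Proof.
elim/last_ind: s => [_|s z IHs].
  rewrite inE /=; apply/eqP/andP => [->|[wy yw]]; first by rewrite anc_refl.
  exact: anc_antisym.
rewrite rcons_path last_rcons -rcons_cons mem_rcons inE => /andP[ws zs].
rewrite (child_anc _ zs) {}IHs // andb_orr; congr (_ || _).
case: eqVneq => [->|]; last by rewrite andbF.
rewrite andbT (child_anc _ zs) orbC; apply/esym/orP; left.
elim/last_ind: s ws {zs} => [_|s u IHs]; first exact: anc_refl.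
rewrite rcons_path last_rcons => /andP[/IHs wl lu].
by rewrite (child_anc _ lu) wl orbT.
Qed.

Lemma child_path w z : anc w z -> exists2 s, path child w s & last w s = z.
Proof.
have [zw|] := eqVneq w z; first by exists [::].
elim/rooted_ind: z => [|z zr IHz wz]; first by rewrite anc_rootE => /negPf->.
rewrite ancE (negPf wz) /= => wpz.
have [s ws ls] : exists2 s, path child w s & last w s = p z.
  by have [->|wpz'] := eqVneq w (p z); [exists [::]|apply: IHz].
exists (rcons s z); last by rewrite last_rcons.
by rewrite rcons_path ws ls /child zr /=.
Qed.

(** * From parent functions to trees *)

Definition parent_adj : rel V :=
  fun x y => (x != y) && ((p x == y) || (p y == x)).

Lemma parent_adj_sym : symmetric parent_adj.
Proof. by move=> x y; rewrite /parent_adj eq_sym orbC. Qed.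

Lemma parent_adj_irr : irreflexive parent_adj.
Proof. by move=> x; rewrite /parent_adj eqxx. Qed.

Definition parent_tree := SGraph parent_adj_sym parent_adj_irr.

Lemma parent_neq v : v != r -> p v != v.
Proof.
by move=> /anc_parentF/negbT; apply: contra => /eqP ->; exact: anc_refl.
Qed.

Lemma parent_tree_root_path (v : parent_tree) :
  exists2 s, @root_path parent_tree r v s & (v != r -> exists s', s = p v :: s').
Proof.
(* That the path meets only ancestors of [v] is what keeps it duplicate-free when a child is put in
   front. *)
suff [s [vs us ls anc_s hs]] : exists s, [/\ path parent_adj v s, uniq (v :: s),
    last v s = r, {in s, forall u, anc u v} & v != r -> exists s', s = p v :: s'].
  by exists s.
elim/rooted_ind: v => [|v vr [s [vs us ls anc_s _]]].
  by exists [::]; split=> //; rewrite eqxx.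
exists (p v :: s); split=> //; last by move=> _; exists s.
- by rewrite /= vs /parent_adj eq_sym parent_neq // eqxx.
- rewrite cons_uniq us andbT; apply/negP; rewrite inE eq_sym (negPf (parent_neq vr)) /=.
  by move=> /anc_s; rewrite anc_parentF.
- move=> u; rewrite inE => /predU1P[->|/anc_s upv]; first exact: anc_parent.
  by apply: anc_trans upv (anc_parent v).
Qed.

(** On a cycle, both neighbours of a deepest vertex are its parent; with more than two vertices the
    neighbours are distinct. *)
Lemma parent_adj_acyclic (s : seq V) : ucycle parent_adj s -> size s <= 2.
Proof.
move=> cs; rewrite leqNgt; apply/negP => s_gt2.
have [x0 x0s] : exists x, x \in s by case: s s_gt2 {cs} => // x s; exists x; rewrite mem_head.
(* The number of ancestors of [x], itself included, serves as its depth. *)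
pose dep x := #|[set y | anc y x]|.
have dep_lt x y : x != y -> p y = x -> dep x < dep y.
  move=> xy py; apply: proper_card; apply/properP; split.
    by apply/subsetP => z; rewrite !inE (ancE z y) py => ->; rewrite orbT.
  exists y; rewrite !inE ?anc_refl // -py anc_parentF //.
  by apply: contraNneq xy => yr; rewrite -py yr rp.1.
case: (arg_maxnP dep x0s) => x xs xmax.
have nbr y : y \in s -> parent_adj x y -> y = p x.
  move=> ys /andP[xy /orP[/eqP //|/eqP py]].
  by have := dep_lt _ _ xy py; rewrite ltnNge (xmax y ys : dep y <= dep x).
have [i t def_t] := rot_to xs.
have ct : ucycle parent_adj (x :: t).
  by case/andP: cs => ? ?; rewrite /ucycle -def_t rot_cycle rot_uniq; apply/andP.
have sz : 2 < size (x :: t) by have := size_rot i s; rewrite def_t => ->.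
have st y : y \in t -> y \in s by rewrite -(mem_rot i s) def_t inE orbC => ->.
case: t sz ct st {def_t} => [//|y t]; case/lastP: t => [//|t z] _.
case/andP; rewrite /= rcons_path last_rcons => /and3P[xy _ zx] /and3P[_ yz _] st.
have ey : y = p x by apply: nbr => //; apply: st; rewrite mem_head.
have ez : z = p x.
  by apply: nbr; [apply: st; rewrite inE mem_rcons mem_head orbT|rewrite parent_adj_sym].
by move: yz; rewrite ey ez mem_rcons mem_head.
Qed.

Lemma parent_tree_is_tree : is_tree parent_tree.
Proof.
split=> [x y|s]; last exact: parent_adj_acyclic.
have to_r z : connect parent_adj z r.
  have [s [zs _ ls] _] := parent_tree_root_path z.
  by apply/connectP; exists s.
apply: connect_trans (to_r x) _.
by rewrite (sym_connect_sym parent_adj_sym); apply: to_r.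
Qed.

End ParentFunction.

(** * From trees to parent functions *)

Section TreeParent.

Variables (T : sgraph) (r : T).
Hypothesis treeT : is_tree T.

Lemma parent_neq_root u v : parent r u v -> v != r.
Proof.
case=> s [_ /andP[vs _] <-].
by apply: contraNneq vs => /= {1}->; apply: mem_last.
Qed.

(* Two distinct neighbours of v towards the root would be joined by a walk
   through the root avoiding v, which closes up to a cycle through v. *)
Lemma parent_unique a b v : parent r a v -> parent r b v -> a = b.
Proof.
move=> [s [/= /andP[va ps] us ls]] [t [/= /andP[vb pt] ut lt]].
apply/eqP/negP => /negP ab.
pose w := s ++ rev (belast b t).
have lw : last a w = b.
  rewrite last_cat ls; case: t {pt ut vb} lt @w => [/= -> //|c t] /= lt.
  by rewrite rev_cons last_rcons.
have pw : path (@adj T) a w.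
  rewrite cat_path ps /= ls -lt rev_path.
  by rewrite (eq_path (e' := @adj T)) // => x y; rewrite adj_sym.
have vw : v \notin a :: w.
  rewrite -cat_cons mem_cat mem_rev negb_or; case/andP: us => -> _ /=.
  by case/andP: ut => vt _; apply: contra vt; apply: mem_belast.
case/shortenP: pw lw => w' pw' uw' sw' lw'.
have /(_ (v :: a :: w')) := treeT.2.
case: w' pw' uw' sw' lw' => [_ _ _ /= eab|c w' pw' uw' sw' lw' H].
  by rewrite eab eqxx in ab.
suff /H : ucycle (@adj T) [:: v, a, c & w'] by [].
apply/andP; split; last first.
  rewrite cons_uniq uw' andbT; apply: contra vw; rewrite !(inE, in_cons).
  by case/orP=> [-> //|/sw' ->]; rewrite orbT.
by move: lw' pw' => /= lw' /andP[ac cw']; rewrite /= rcons_path lw' va ac cw' adj_sym.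
Qed.

(** For [v != r], [p v] is the second vertex of some path from [v] to the root; by [parent_unique]
    it does not depend on the path. *)
Lemma tree_parent_function :
  exists2 p : T -> T, rooted p r & forall u v, parent r u v <-> child p r u v.
Proof.
have path_to v : exists s, root_path r v s.
  have /connectP[s vs ->] := treeT.1 v r.
  by case/shortenP: vs => s' vs' us' _; exists s'.
have [p p_spec] : exists p : T -> T,
    forall v, if v == r then p v = r else parent r (p v) v.
  apply: (@fin_all_exists _ (fun=> T) (fun v u => if v == r then u = r else parent r u v)).
  move=> v; case: eqVneq => [_|vr]; first by exists r.
  have [[|u s] vs] := path_to v; last by exists u, s.
  by case: vs => _ _ /= vr'; rewrite vr' eqxx in vr.
have pP u v : parent r u v -> p v = u.
  move=> uv; have := p_spec v; rewrite (negPf (parent_neq_root uv)) => pv.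
  exact: parent_unique pv uv.
exists p => [|u v].
  split=> [|v]; first by have := p_spec r; rewrite eqxx.
  have [s] := path_to v; elim: s v => [v [_ _ /= ->] //|u s IHs v vs].
  apply: (connect_trans (y := u)).
    by rewrite -(pP u v) ?fconnect1 //; exists s.
  by apply: IHs; case: vs => /= /andP[_ us] /andP[_ uus].
split=> [uv|/andP[vr /eqP <-]]; last by have := p_spec v; rewrite (negPf vr).
by rewrite /child (parent_neq_root uv) (pP u v) ?eqxx.
Qed.

End TreeParent.

(** Existence of the parent comes from the explicit path to the root, uniqueness from acyclicity. *)
Lemma parent_treeP (V : finType) (p : V -> V) (r : V) (rp : rooted p r) u v :
  @parent (parent_tree p) r u v <-> child p r u v.
Proof.
have parP w : w != r -> @parent (parent_tree p) r (p w) w.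
  move=> wr; have [s ws /(_ wr)[s' def_s]] := parent_tree_root_path rp w.
  by exists s'; rewrite -def_s.
split=> [uv|/andP[vr /eqP <-]]; last exact: parP.
have vr := parent_neq_root uv; apply/andP; split=> //; apply/eqP.
exact: (parent_unique (parent_tree_is_tree rp) (parP v vr) uv).
Qed.

Lemma branchP (T : sgraph) (r : T) (p : T -> T) (s : seq T) :
  (forall u v, parent r u v <-> child p r u v) ->
  branch r s <-> sorted (child p r) s.
Proof.
move=> parP; case: s => [|w s]; first by split=> // _ x0 i.
split=> [br|/sortedP srt x0 i lt_i].
  by apply/(sortedP w) => i lt_i; apply/parP/br.
by apply/parP/srt.
Qed.
(** * Burling graphs are derived *)

(* A Burling tree on the vertices of P from which P is fully derived and whose
   root-to-leaf branches are the members of the family of P; lb is the last-born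
   and ch the choose function. *)
Record tree_model (P : stgraph) := TreeModel {
  par : P -> P;
  rt : P;
  lb : P -> option P;
  ch : P -> {set P};
  par_rooted : rooted par rt;
  lb_child : forall v w, lb v = Some w -> child par rt v w;
  lb_nonleaf : forall v w, child par rt v w -> lb v <> None;
  ch_root : ch rt = set0;
  ch_lb : forall v w, lb v = Some w -> ch w = set0;
  ch_branch : forall u v w, child par rt u v -> lb u = Some w -> v <> w ->
    exists2 z, anc par w z & ch v = [set y | anc par w y && anc par y z];
  adj_ch : forall u v, adj u v = (u \in ch v) || (v \in ch u);
  family_leaf : forall S, S \in family P <->
    exists2 z, lb z = None & S = [set y | anc par y z] }.

Lemma derived_of_model (P : stgraph) (M : tree_model P) (A : {set P}) (H : sgraph) :
  isomorphic (@adj H) (induced (@adj P) A) -> derived_graph H.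
Proof.
case: M => p r l c rp l_child l_nonleaf c_root c_lb c_branch adj_c _ [g bij_g adj_g].
pose T := parent_tree p; have parP := parent_treeP rp.
have l_child' v w : l v = Some w -> @parent T r v w by move=> /l_child/parP.
have l_nonleaf' v w : @parent T r v w -> l v <> None by move=> /parP/l_nonleaf.
have c_branch' u v w : @parent T r u v -> l u = Some w -> v <> w ->
    exists2 s, @branch_from T r w s & c v = [set x in s].
  move=> /parP uv lu vw; have [z wz ->] := c_branch u v w uv lu vw.
  have [s ws ls] := child_path rp wz; exists (w :: s).
    by split=> //; apply/(branchP _ parP).
  by apply/setP => y; rewrite !in_set (mem_child_path rp _ ws) ls.
exists (@BurlingTree T r l c (parent_tree_is_tree rp) l_child' l_nonleaf' c_root
  c_lb c_branch'), A; exists g => // x y.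
by rewrite -adj_g /underlying /induced /full_arc /= adj_c orbC.
Qed.

Definition K1_model : tree_model (STGraph K1_stable).
Proof.
apply: (@TreeModel (STGraph K1_stable) id tt (fun=> None) (fun=> set0)) => //.
- by split=> // [[]]; apply: connect0.
- by move=> [] [] /=; rewrite inE.
move=> S; rewrite inE; split=> [/eqP->|[[] _ ->]].
  by exists tt => //; apply/setP => [[]]; rewrite !inE /anc connect0.
by apply/eqP/setP => [[]]; rewrite !inE /anc connect0.
Defined.

Definition to_member (P : stgraph) S (SP : S \in family P) : member P :=
  exist _ S SP.

Lemma val_to_member (P : stgraph) (S : {set P}) (SP : S \in family P) :
  val (to_member SP) = S.
Proof. by []. Qed.

(** * Membership in the stable sets of the next family *)

Section UnionMembership.

Variables (P : stgraph) (S Q : member P).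

Lemma base_inj : injective (@base P). Proof. by move=> x y []. Qed.
Lemma copy_inj X : injective (@copy P X). Proof. by move=> x y []. Qed.

Lemma base_union_old x : (base x \in (union_old S Q : {set next P})) = (x \in val S).
Proof.
rewrite inE (mem_imset _ _ base_inj); case: (x \in val S) => //=.
by apply/imsetP => [[]].
Qed.

Lemma copy_union_old X x :
  (copy X x \in (union_old S Q : {set next P})) = (X == S) && (x \in val Q).
Proof.
rewrite inE; case: imsetP => [[]//|_] /=; case: eqVneq => [->|XS] /=.
  exact/mem_imset/copy_inj.
by apply/imsetP => [[y _ [/eqP]]]; rewrite (negPf XS).
Qed.

Lemma new_union_old X Y : (new X Y \in (union_old S Q : {set next P})) = false.
Proof. by rewrite inE; apply/orP => [[]] /imsetP[]. Qed.

Lemma base_union_new x : (base x \in (union_new S Q : {set next P})) = (x \in val S).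
Proof. by rewrite !inE (mem_imset _ _ base_inj) orbF. Qed.

Lemma copy_union_new X x : (copy X x \in (union_new S Q : {set next P})) = false.
Proof. by rewrite !inE orbF; apply/imsetP => [[]]. Qed.

Lemma new_union_new X Y : (new X Y \in (union_new S Q : {set next P})) = (X == S) && (Y == Q).
Proof. by rewrite !inE; case: imsetP => [[]//|_] /=. Qed.

Lemma union_old_family : union_old S Q \in family (next P).
Proof. by rewrite inE; apply/orP; left; apply/imset2P; exists S Q. Qed.

Lemma union_new_family : union_new S Q \in family (next P).
Proof. by rewrite inE; apply/orP; right; apply/imset2P; exists S Q. Qed.

End UnionMembership.

Definition union_memE := (val_to_member, base_union_old, copy_union_old, new_union_old,
  base_union_new, copy_union_new, new_union_new).

(** * The Burling tree of [next P] *)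

Section NextModel.

Variables (P : stgraph) (M : tree_model P).

Local Notation p := (par M).
Local Notation r := (rt M).
Local Notation oanc := (anc p).
Let rp := par_rooted M.

(** The leaf that ends the branch [S]. It exists by [family_leaf], so the default [r] is never
    returned for want of a candidate. *)
Definition leaf_of (S : member P) : P :=
  odflt r [pick z | (lb M z == None) && (val S == [set y | oanc y z])].

Lemma leaf_ofP S : lb M (leaf_of S) = None /\ val S = [set y | oanc y (leaf_of S)].
Proof.
have /(family_leaf M)[z lz Sz] := valP S.
rewrite /leaf_of; case: pickP => [w /andP[/eqP ? /eqP ?] //|/(_ z)].
by rewrite lz {1}Sz !eqxx.
Qed.

Lemma mem_leaf_of (S : member P) y : (y \in val S) = oanc y (leaf_of S).
Proof. by rewrite (leaf_ofP S).2 inE. Qed.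

Lemma leaf_of_eq (S : member P) z : val S = [set y | oanc y z] -> leaf_of S = z.
Proof.
move=> Sz; apply: (anc_antisym rp).
  by have := mem_leaf_of S (leaf_of S); rewrite Sz inE anc_refl.
by rewrite -mem_leaf_of Sz inE anc_refl.
Qed.

Definition next_par (u : next P) : next P :=
  match u with
  | inl (inl x) => base (p x)
  | inl (inr (X, x)) => if x == r then base (leaf_of X) else copy X (p x)
  | inr (X, Q) => base (leaf_of X)
  end.

Definition next_rt : next P := base r.

(** When [x] is a leaf, its ancestors form a member of the family, so [insub] succeeds and the root
    of the corresponding copy becomes the last-born. *)
Definition next_lb (u : next P) : option (next P) :=
  match u with
  | inl (inl x) => if lb M x is Some w then Some (base w)
                   else omap (fun S => copy S r) (insub [set y | oanc y x])
  | inl (inr (X, x)) => omap (copy X) (lb M x)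
  | inr _ => None
  end.

Definition next_ch (u : next P) : {set next P} :=
  match u with
  | inl (inl x) => @base P @: ch M x
  | inl (inr (X, x)) => copy X @: ch M x
  | inr (X, Q) => copy X @: val Q
  end.

Local Notation nanc := (anc next_par).
Local Notation nchild := (child next_par next_rt).

Lemma next_rooted : rooted next_par next_rt.
Proof.
have base_rt x : fconnect next_par (base x) next_rt.
  elim/(rooted_ind rp): x => [|x _ IHx]; first exact: connect0.
  by apply: connect_trans IHx; apply: fconnect1.
split=> [|[[x|[S x]]|[S Q]]]; first by rewrite /= rp.1.
- exact: base_rt.
- elim/(rooted_ind rp): x => [|x xr IHx].
    apply: (connect_trans (fconnect1 _ _)); rewrite /= eqxx; exact: base_rt.
  apply: connect_trans IHx; apply: (connect_trans (fconnect1 _ _)).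
  by rewrite /= (negPf xr); apply: connect0.
- by apply: (connect_trans (fconnect1 _ _)); exact: base_rt.
Qed.

Lemma anc_next_base u y :
  nanc u (base y) = if u is inl (inl x) then oanc x y else false.
Proof.
elim/(rooted_ind rp): y => [|y yr IHy].
  rewrite (anc_rootE next_rooted).
  by case: u => [[x|[S x]]|[S Q]] //; rewrite (anc_rootE rp).
rewrite ancE {}IHy; case: u => [[x|[S x]]|[S Q]] //=.
by rewrite [in RHS]ancE.
Qed.

(** The way up from a vertex of the copy at [S] reaches the root of that copy, then jumps to
    [leaf_of S], whose ancestors are exactly the elements of [S]. *)
Lemma anc_next_copy u S y :
  nanc u (copy S y) = match u with
    | inl (inl x) => x \in val S
    | inl (inr (X, x)) => (X == S) && oanc x y
    | inr _ => false
    end.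
Proof.
elim/(rooted_ind rp): y => [|y yr IHy].
  rewrite ancE /= eqxx anc_next_base.
  case: u => [[x|[X x]]|[X Q]] //=; first by rewrite mem_leaf_of.
  by rewrite orbF (anc_rootE rp).
rewrite ancE /= (negPf yr) {}IHy; case: u => [[x|[X x]]|[X Q]] //=.
rewrite [in RHS]ancE andb_orr.
by congr (_ || _).
Qed.

Lemma anc_next_new u S Q :
  nanc u (new S Q) = (u == new S Q) || (if u is inl (inl x) then x \in val S else false).
Proof.
rewrite ancE /= anc_next_base; congr (_ || _).
by case: u => [[x|[X x]]|[X Y]] //=; rewrite mem_leaf_of.
Qed.

Lemma next_lb_leaf S : next_lb (base (leaf_of S)) = Some (copy S r).
Proof.
rewrite /= (leaf_ofP S).1; have := (leaf_ofP S).2 => <-.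
by rewrite valK.
Qed.

Lemma child_par v : v != r -> child p r (p v) v.
Proof. by move=> vr; rewrite /child vr /=. Qed.

Lemma next_lb_child v w : next_lb v = Some w -> nchild v w.
Proof.
case: v => [[x|[X x]]|[X Q]] //=; last first.
  case lx: (lb M x) => [z|//] [<-]; have /andP[zr /eqP pz] := lb_child lx.
  by rewrite /child /= (negPf zr) pz.
case lx: (lb M x) => [z|] => [[<-]|].
  have /andP[zr /eqP pz] := lb_child lx.
  by apply/andP; split; [apply: contra zr => /eqP[->]|rewrite /= pz].
case: insubP => //= S _ Sx [<-].
by rewrite /child /= eqxx (leaf_of_eq Sx).
Qed.

Lemma next_lb_nonleaf v w : nchild v w -> next_lb v <> None.
Proof.
case/andP=> wr /eqP <-; case: w wr => [[y|[Y y]]|[Y Q]] wr.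
- have yr : y != r by apply: contra wr => /eqP->.
  by rewrite /=; have := lb_nonleaf (child_par yr); case: (lb M _).
- rewrite /=; case: eqVneq => [_|yr]; first by rewrite next_lb_leaf.
  by rewrite /=; have := lb_nonleaf (child_par yr); case: (lb M _).
- by rewrite [next_par _]/= next_lb_leaf.
Qed.

Lemma next_ch_root : next_ch next_rt = set0.
Proof. by rewrite /= ch_root imset0. Qed.

Lemma next_ch_lb v w : next_lb v = Some w -> next_ch w = set0.
Proof.
case: v => [[x|[X x]]|[X Q]] //=; last first.
  by case lx: (lb M x) => [z|//] [<-]; rewrite /= (ch_lb lx) imset0.
case lx: (lb M x) => [z|] => [[<-]|]; first by rewrite /= (ch_lb lx) imset0.
by case: insubP => //= S _ _ [<-]; rewrite /= ch_root imset0.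
Qed.

Lemma next_ch_branch u v w : nchild u v -> next_lb u = Some w -> v <> w ->
  exists2 z, nanc w z & next_ch v = [set y | nanc w y && nanc y z].
Proof.
case/andP=> vr /eqP <-; case: v vr => [[x|[X x]]|[X Q]] vr.
- have xr : x != r by apply: contra vr => /eqP->.
  rewrite /=; case lx: (lb M (p x)) => [w0|] => [[<-] xw|]; last first.
    by have := lb_nonleaf (child_par xr).
  have [|z wz cz] := ch_branch (child_par xr) lx.
    by move=> xw0; apply: xw; rewrite xw0.
  exists (base z); first by rewrite anc_next_base.
  apply/setP => [[[y|[Y y]]|[Y Q]]]; rewrite inE !anc_next_base ?andbF.
  + by rewrite (mem_imset _ _ (@base_inj P)) cz inE.
  + by apply/imsetP => [[]].
  + by apply/imsetP => [[]].
(* The root of a copy is itself the last-born, which [v <> w] excludes; any other vertex inherits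
   its branch inside the copy. *)
- rewrite /=; case: eqVneq => [->|xr]; first by rewrite next_lb_leaf => [[<-]].
  rewrite /=; case lx: (lb M (p x)) => [w0|] => [[<-] xw|]; last first.
    by have := lb_nonleaf (child_par xr).
  have [|z wz cz] := ch_branch (child_par xr) lx.
    by move=> xw0; apply: xw; rewrite xw0.
  exists (copy X z); first by rewrite anc_next_copy /= eqxx.
  apply/setP => [[[y|[Y y]]|[Y Q]]]; rewrite inE.
  + by rewrite anc_next_base; apply/imsetP => [[]].
  + rewrite !anc_next_copy /= (eq_sym X); case: eqVneq => [->|YX] /=.
      by rewrite (mem_imset _ _ (@copy_inj P X)) cz inE.
    by apply/imsetP => [[y' _ [/eqP]]]; rewrite (negPf YX).
  + by rewrite anc_next_copy andbF; apply/imsetP => [[]].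
(* The branch of [new X Q] starts at the root of the copy at [X] and ends at the copy of
   [leaf_of Q], so it is the whole copy of [Q]. *)
- rewrite [next_par _]/= next_lb_leaf => [[<-]] _.
  exists (copy X (leaf_of Q)); first by rewrite anc_next_copy /= eqxx (anc_root rp).
  apply/setP => [[[y|[Y y]]|[Y Q']]]; rewrite inE.
  + by rewrite anc_next_base; apply/imsetP => [[]].
  + rewrite !anc_next_copy /= (anc_root rp) andbT (eq_sym X).
    case: eqVneq => [->|YX] /=.
      by rewrite (mem_imset _ _ (@copy_inj P X)) mem_leaf_of.
    by apply/imsetP => [[y' _ [/eqP]]]; rewrite (negPf YX).
  + by rewrite anc_next_copy andbF; apply/imsetP => [[]].
Qed.

Lemma mem_copy_imset (X Y : member P) y (A : {set P}) :
  (copy Y y \in copy X @: A) = (X == Y) && (y \in A).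
Proof.
rewrite (eq_sym X); case: eqVneq => [->|YX] /=; first exact/mem_imset/copy_inj.
by apply/imsetP => [[y' _ [/eqP]]]; rewrite (negPf YX).
Qed.

Lemma next_adj_ch u v : next_adj u v = (u \in next_ch v) || (v \in next_ch u).
Proof.
have base_copyF x X (A : {set P}) : (base x \in copy X @: A) = false.
  by apply/imsetP => [[]].
have copy_baseF x X (A : {set P}) : (copy X x \in @base P @: A) = false.
  by apply/imsetP => [[]].
have new_baseF Q X (A : {set P}) : (new X Q \in @base P @: A) = false.
  by apply/imsetP => [[]].
have new_copyF Q X Y (A : {set P}) : (new Y Q \in copy X @: A) = false.
  by apply/imsetP => [[]].
case: u v => [[x|[X x]]|[X Q]] [[y|[Y y]]|[Y Q']];
  rewrite [next_adj _ _]/= [next_ch _]/= [next_ch _ in X in _ || X]/=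
    ?(base_copyF, copy_baseF, new_baseF, new_copyF) //
    ?(mem_imset _ _ (@base_inj P)) ?mem_copy_imset ?orbF //.
- exact: adj_ch.
- by rewrite (adj_ch M) eq_sym; case: eqVneq.
Qed.

(** The leaves of the new tree are the copied leaves and the vertices [new X Q]; the branches ending
    there are the two kinds of unions. *)
Lemma family_next (S : {set next P}) : S \in family (next P) <->
  exists2 z, next_lb z = None & S = [set y | nanc y z].
Proof.
have old_anc X z (Q : member P) : val Q = [set y | oanc y z] ->
    union_old X Q = [set y | nanc y (copy X z)].
  move=> Qz; apply/setP => [[[y|[Y y]]|[Y Q']]]; rewrite [RHS]inE anc_next_copy.
  - by rewrite base_union_old.
  - by rewrite copy_union_old Qz inE.
  - by rewrite new_union_old.
have new_anc X Q : union_new X Q = [set y | nanc y (new X Q)].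
  apply/setP => [[[y|[Y y]]|[Y Q']]]; rewrite [RHS]inE anc_next_new.
  - by rewrite base_union_new.
  - by rewrite copy_union_new.
  - by rewrite new_union_new orbF.
split=> [|[z lz ->]].
  rewrite inE => /orP[] /imset2P[X Q _ _ ->]; last by exists (new X Q).
  exists (copy X (leaf_of Q)); first by rewrite /= (leaf_ofP Q).1.
  exact/old_anc/(leaf_ofP Q).2.
case: z lz => [[z|[X z]]|[X Q]] lz; last by rewrite -new_anc union_new_family.
  (* A leaf of the first copy ends a member, below which a copy now hangs, so it is no longer a
     leaf. *)
  move: lz => /=; case lz: (lb M z) => //.
  have fz : [set y | oanc y z] \in family P by apply/(family_leaf M); exists z.
  by rewrite insubT.
move: lz => /=; case lz: (lb M z) => // _.
have fz : [set y | oanc y z] \in family P by apply/(family_leaf M); exists z.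
by rewrite -(old_anc X z (to_member fz)) // union_old_family.
Qed.

Definition next_model : tree_model (next P) :=
  TreeModel next_rooted next_lb_child next_lb_nonleaf next_ch_root next_ch_lb
    next_ch_branch next_adj_ch family_next.

End NextModel.

Lemma burling_derived (H : sgraph) : burling_graph H -> derived_graph H.
Proof.
case=> k _ [A HA]; suff M : tree_model (burling k) by exact: derived_of_model HA.
by rewrite /burling; elim: k.-1 => [|n M]; [apply: K1_model|apply: next_model].
Qed.

(** * Derived graphs are Burling graphs *)

Section Embedding.

Variables (V : finType) (e le : rel V).

(** [le] will be the ancestor order; the last clause then makes each branch from the top of [X] the
    trace of a member. The map [g] is constrained on [X] only. *)
Definition embeds (X : {set V}) (P : stgraph) := exists g : V -> P,
  [/\ {in X &, injective g},
      {in X &, forall u v, adj (g u) (g v) = e u v} &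
      forall w, w \in X ->
        exists S : member P, {in X, forall y, (g y \in val S) = le y w}].

Lemma embeds_next X P : embeds X P -> embeds X (next P).
Proof.
case=> g [inj_g adj_g tr_g]; exists (fun u => base (g u)); split=> //.
  by move=> u v uX vX /base_inj; apply: inj_g.
(* The second component is arbitrary, since the image avoids all the copies. *)
move=> w /tr_g[S Sw]; exists (to_member (union_old_family S S)) => y yX /=.
by rewrite base_union_old Sw.
Qed.

(* The top x of X is isolated, so it can be moved to the first copy of P, inside
   S0; the rest of X goes to the copy P_{S0}.  There v_{S0,Q} sees the branch of X
   ending at t except x, and serves as v.  As v is isolated in Y, the rest of Y
   can be placed in the copy of next P attached to S0 + v_{S0,Q}. *)
Lemma embeds_graft X Y P (x v t : V) :
    embeds X P -> embeds Y (next P) -> [disjoint X & Y] ->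
    x \in X -> v \in Y -> t \in X -> symmetric e ->
    {in X, forall y, le x y} -> {in Y, forall z, le v z} ->
    {in X & Y, forall y z, le y z = (y == x)} ->
    {in X & Y, forall y z, le z y = false} ->
    {in X, forall y, e x y = false} -> {in Y, forall z, e v z = false} ->
    {in X & Y, forall y z, e y z = [&& z == v, y != x & le y t]} ->
  embeds (X :|: Y) (next (next P)).
Proof.
move=> [g [inj_g adj_g tr_g]] [h [inj_h adj_h tr_h]] dXY xX vY tX e_sym.
move=> le_x le_v le_XY le_YX e_x e_v e_XY.
have [S0 S0P] := tr_g x xX; have [Q QP] := tr_g t tX.
(* Among the images of [X] and [v], only those of [x] and [v] lie in [S1]: these two must precede
   the rest of [Y] on every branch. *)
pose S1 : member (next P) := to_member (union_new_family S0 Q).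
pose f u : next (next P) :=
  if u \in X then if u == x then @base (next P) (base (g x))
    else @base (next P) (copy S0 (g u))
  else if u == v then @base (next P) (new S0 Q) else copy S1 (h u).
have YX z : z \in Y -> z \in X = false.
  by move=> zY; apply/negP => zX; have := disjointFr dXY zX; rewrite zY.
have cases u : u \in X :|: Y ->
    [\/ u = x /\ f u = @base (next P) (base (g x)),
        [/\ u \in X, u != x & f u = @base (next P) (copy S0 (g u))],
        u = v /\ f u = @base (next P) (new S0 Q) |
        [/\ u \in Y, u != v & f u = copy S1 (h u)]].
  rewrite inE /f; case: (eqVneq u x) => [->|ux]; first by rewrite xX; constructor 1.
  case: (eqVneq u v) => [->|uv] uXY; first by rewrite YX //; constructor 3.
  by case/orP: uXY => uXY; [rewrite uXY; constructor 2|rewrite YX //; constructor 4].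
have g_x : g x \in val S0 by rewrite S0P // le_x.
have e_YX y z : y \in X -> z \in Y -> e z y = [&& z == v, y != x & le y t].
  by move=> *; rewrite e_sym e_XY.
exists f; split.
- move=> u w /cases[[-> ->]|[uX ux ->]|[-> ->]|[uY uv ->]]
    /cases[[-> ->]|[wX wx ->]|[-> ->]|[wY wv ->]] // [].
  + exact: inj_g.
  + exact: inj_h.
- move=> u w /cases[[-> ->]|[uX ux ->]|[-> ->]|[uY uv ->]]
    /cases[[-> ->]|[wX wx ->]|[-> ->]|[wY wv ->]] /=.
  + by rewrite adj_irr e_x.
  + by rewrite e_x.
  + by rewrite e_XY // !eqxx.
  + by rewrite e_XY // (negPf wv).
  + by rewrite e_sym e_x.
  + by rewrite eqxx adj_g.
  + by rewrite e_XY // !eqxx ux QP.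
  + by rewrite e_XY // (negPf wv).
  + by rewrite e_YX // !eqxx.
  + by rewrite e_YX // !eqxx wx QP.
  + by rewrite e_v.
  + by rewrite e_v.
  + by rewrite e_YX // (negPf uv).
  + by rewrite e_YX // (negPf uv).
  + by rewrite e_sym e_v.
  + by rewrite eqxx; apply: adj_h.
move=> w; rewrite inE => /orP[wX|wY].
  have [R RP] := tr_g w wX.
  pose R1 : member (next P) := to_member (union_old_family S0 R).
  (* A union of the new kind contains no vertex of a copy, so it avoids [Y] minus [v]; [R1] itself
     omits the image of [v]. *)
  exists (to_member (union_new_family R1 R1)) => y.
  case/cases => [[-> ->]|[yX yx ->]|[-> ->]|[yY yv ->]].
  + by rewrite !union_memE g_x le_x.
  + by rewrite !union_memE eqxx RP.
  + by rewrite !union_memE le_YX.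
  + by rewrite !union_memE le_YX.
have [R RP] := tr_h w wY.
(* [S1] contributes [x] and [v], and the copy of [R] contributes the rest of the branch inside
   [Y]. *)
exists (to_member (union_old_family S1 R)) => y.
case/cases => [[-> ->]|[yX yx ->]|[-> ->]|[yY yv ->]].
+ by rewrite !union_memE g_x le_XY ?eqxx.
+ by rewrite !union_memE le_XY ?(negPf yx).
+ by rewrite !union_memE !eqxx le_v.
+ by rewrite !union_memE eqxx RP.
Qed.

End Embedding.

(** * Embedding the subtrees of a Burling tree *)

Section TreeEmbedding.

Variables (V : finType) (p : V -> V) (r : V).
Variables (lb : V -> option V) (c : V -> {set V}).

Local Notation anc := (anc p).
Local Notation child := (child p r).

Hypothesis rp : rooted p r.
Hypothesis lb_child : forall u w, lb u = Some w -> child u w.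
Hypothesis lb_nonleaf : forall u v, child u v -> lb u <> None.
Hypothesis c_root : c r = set0.
Hypothesis c_lb : forall u w, lb u = Some w -> c w = set0.
Hypothesis c_branch : forall u v w, child u v -> lb u = Some w -> v <> w ->
  c v = set0 \/ exists2 z, anc w z & c v = [set y | anc w y && anc y z].

Definition choose_edge : rel V := fun u v => (u \in c v) || (v \in c u).

Local Notation e := choose_edge.
Local Notation subtree x := [set y | anc x y].
Local Notation embeds_seq n X := (embeds e anc X (iter n next (STGraph K1_stable))).

Lemma choose_edge_sym : symmetric e.
Proof. by move=> u v; rewrite /e orbC. Qed.

Lemma choose_spec u v : child u v -> c v = set0 \/
  exists w z, [/\ lb u = Some w, v != w, anc w z & c v = [set y | anc w y && anc y z]].
Proof.
move=> uv; case lu: (lb u) => [w|]; last by have := lb_nonleaf uv.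
have [->|vw] := eqVneq v w; first by left; apply: c_lb lu.
have [|cv|[z wz cv]] := c_branch uv lu; [exact/eqP|by left|].
by right; exists w, z.
Qed.

Lemma mem_choose a b : b \in c a -> child (p a) a /\
  exists w, [/\ lb (p a) = Some w, a != w & anc w b].
Proof.
have [->|ar] := eqVneq a r; first by rewrite c_root inE.
have pa : child (p a) a by rewrite /child ar /=.
case: (choose_spec pa) => [->|[w [z [lw aw wz ->]]]]; first by rewrite inE.
by rewrite inE => /andP[wb _]; split=> //; exists w.
Qed.

(** An arc leaving [a] ends below a sibling of [a], hence below every proper ancestor of [a]. *)
Lemma anc_choose u a b : b \in c a -> anc u a -> u != a -> anc u b.
Proof.
case/mem_choose=> pa [w [/lb_child pw _ wb]]; rewrite (child_anc _ pa) => /orP[->//|upa] _.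
apply: anc_trans wb; apply: anc_trans upa _.
by rewrite (child_anc _ pw) anc_refl orbT.
Qed.

(** One end of an arc is a vertex, the other lies below a different sibling of it; comparable ends
    would give two siblings a common descendant. *)
Lemma choose_edge_anc x y : anc x y -> e x y = false.
Proof.
move=> xy; apply/norP; split; apply/negP => /mem_choose.
  case=> py [w [/lb_child pw yw wx]].
  have /eqP[] := yw; apply: (siblings_eq rp py pw (w := y)); first exact: anc_refl.
  exact: anc_trans wx xy.
case=> px [w [/lb_child pw xw wy]].
by case/eqP: xw; apply: (siblings_eq rp px pw xy wy).
Qed.

Definition hung x (l : seq V) := x |: [set y | has (fun v => anc v y) l].

Lemma mem_hung x l y :
  reflect (y = x \/ exists2 v, v \in l & anc v y) (y \in hung x l).
Proof.
rewrite !inE; apply: (iffP orP) => [[/eqP|/hasP]|[/eqP|/hasP]]; by [left|right].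
Qed.

Lemma hung_nil x : hung x [::] = [set x].
Proof. by apply/setP => y; rewrite !inE orbF. Qed.

Lemma hung_cons x v l : hung x (v :: l) = hung x l :|: subtree v.
Proof. by apply/setP => y; rewrite !inE /= orbCA orbC. Qed.

Lemma embeds_mono n m X : n <= m -> embeds_seq n X -> embeds_seq m X.
Proof.
move=> /subnK <-; elim: (m - n) => // k IHk /IHk.
by rewrite addSn /=; apply: embeds_next.
Qed.

Lemma embeds_hung_cons n x v l :
    {in v :: l, forall u, child x u} -> v \notin l ->
    {in v :: l, forall u, c u \subset hung x l} ->
    embeds_seq n (hung x l) -> embeds_seq n (subtree v) ->
  embeds_seq n.+2 (hung x (v :: l)).
Proof.
move=> ch vl c_hung emb_l emb_v; rewrite hung_cons.
have xv : child x v by apply: ch; rewrite mem_head.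
have chl u : u \in l -> child x u by move=> ul; apply: ch; rewrite inE ul orbT.
have ancx u y : child x u -> anc u y -> anc x y.
  by move=> xu uy; apply: anc_trans uy; rewrite (child_anc _ xu) anc_refl orbT.
have disj y : y \in hung x l -> anc v y = false.
  case/mem_hung=> [->|[u ul uy]]; first exact: child_ancF xv.
  apply/negP => vy; case/negP: vl.
  by rewrite (siblings_eq rp xv (chl u ul) vy uy).
(* [t] is the last vertex of the branch chosen by [v], or [x] if that branch is empty, so that
   nothing but [x] lies above [t] in the hung part. *)
have [t tX tP] : exists2 t, t \in hung x l &
    {in hung x l, forall y, (y != x) && anc y t = (y \in c v)}.
  have [cv|[w [z [lw vw wz cv]]]] := choose_spec xv.
    exists x => [|y /mem_hung yX]; first by rewrite !inE eqxx.
    rewrite cv inE; case: eqVneq => //= yx.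
    apply/negP => y_x; case/eqP: yx; apply: (anc_antisym rp) => //.
    by case: yX => [->|[u /chl xu uy]]; [exact: anc_refl|exact: ancx xu uy].
  (* A nonempty choice contains the last-born [w], so [w] has been hung before [v]. *)
  have wl : w \in l.
    have : w \in hung x l.
      by apply: (subsetP (c_hung v (mem_head _ _))); rewrite cv inE anc_refl.
    case/mem_hung=> [wx|[u ul uw]].
      by have := child_ancF rp (lb_child lw); rewrite wx anc_refl.
    by rewrite -(siblings_eq rp (chl u ul) (lb_child lw) uw (anc_refl p w)).
  exists z => [|y /mem_hung yX]; first by apply/mem_hung; right; exists w.
  rewrite cv inE; case: eqVneq yX => [->|yx] /=.
    by rewrite (child_ancF rp (lb_child lw)).
  case=> [yx'|[u ul uy]]; first by rewrite yx' eqxx in yx.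
  apply/idP/andP => [yz|[]//]; split=> //.
  by rewrite -(siblings_eq rp (chl u ul) (lb_child lw) (anc_trans uy yz) wz).
have le_x : {in hung x l, forall y, anc x y}.
  by move=> y /mem_hung[->|[u /chl xu uy]]; [exact: anc_refl|exact: ancx xu uy].
have xX : x \in hung x l by apply/mem_hung; left.
apply: (@embeds_graft _ e anc (hung x l) (subtree v) _ x v t) => //.
- exact: embeds_next.
- by rewrite disjoint_subset; apply/subsetP => y /disj; rewrite !inE => ->.
- by rewrite inE anc_refl.
- exact: choose_edge_sym.
- by move=> z; rewrite inE.
- move=> y z yX; rewrite inE => vz; case: eqVneq => [->|yx]; first exact: ancx vz.
  apply/negP => yz; case/mem_hung: yX => [yx'|[u ul uy]]; first by rewrite yx' eqxx in yx.
  have /disj : z \in hung x l by apply/mem_hung; right; exists u => //; apply: anc_trans uy yz.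
  by rewrite vz.
- move=> y z yX; rewrite inE => vz; apply/negP => zy.
  by have := disj y yX; rewrite (anc_trans vz zy).
- by move=> y yX; apply/choose_edge_anc/le_x.
- by move=> z; rewrite inE; apply: choose_edge_anc.
(* No arc goes from the hung part into the subtree of [v], and an arc in the other direction can
   leave only from [v]: below [v], [anc_choose] confines it to the subtree. *)
move=> y z yX; rewrite inE => vz.
have [->|yx] := eqVneq y x; first by rewrite andbF choose_edge_anc //; exact: ancx vz.
have zX : (z \in hung x l) = false by apply/negP => /disj; rewrite vz.
have zy : (z \in c y) = false.
  apply/negP => zy; case/negP: (negbT zX).
  case/mem_hung: yX => [yx'|[u ul uy]]; first by rewrite yx' eqxx in yx.
  have [uy'|uy'] := eqVneq u y.
    by apply: (subsetP (c_hung y _)) zy; rewrite -uy' inE ul orbT.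
  by apply/mem_hung; right; exists u => //; apply: anc_choose zy uy uy'.
rewrite /e zy orbF; have [->|zv] := eqVneq z v; first by rewrite -tP // yx.
apply/negP => /anc_choose/(_ vz); rewrite eq_sym => /(_ zv).
by rewrite disj.
Qed.

Lemma embeds_singleton x : embeds_seq 0 [set x].
Proof.
exists (fun=> tt); split=> [u v /set1P-> /set1P-> //|u v /set1P-> /set1P->|w /set1P->].
  by rewrite choose_edge_anc // anc_refl.
exists (@to_member (STGraph K1_stable) [set: K1] (set11 _)) => y /set1P->.
by rewrite anc_refl val_to_member inE.
Qed.

Lemma subtree_hung x l : (forall v, child x v = (v \in l)) -> subtree x = hung x l.
Proof.
move=> ch; apply/setP => y; rewrite inE; apply/idP/mem_hung.
  case/(child_path rp) => [[|v s] /=]; first by left.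
  case/andP=> xv vs <-; right; exists v; first by rewrite -ch.
  by have := mem_last v s; rewrite (mem_child_path rp _ vs) => /andP[].
case=> [->|[v]]; first exact: anc_refl.
rewrite -ch => xv vy; apply: anc_trans vy.
by rewrite (child_anc _ xv) anc_refl orbT.
Qed.

(** Strong induction on the size of the subtree: the subtrees of the children embed, and are hung
    one at a time below [x]. *)
Lemma embeds_subtree x : exists n, embeds_seq n (subtree x).
Proof.
have [k] := ubnP #|subtree x|; elim: k x => // k IHk x xk.
have IH v : child x v -> exists n, embeds_seq n (subtree v).
  move=> xv; apply: IHk; apply: leq_trans (xk : #|_| <= k).
  apply: proper_card; apply/properP; split.
    apply/subsetP => y; rewrite !inE; apply: anc_trans.
    by rewrite (child_anc _ xv) anc_refl orbT.
  by exists x; rewrite inE ?anc_refl // (child_ancF rp xv).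
have grow v l : {in v :: l, forall u, child x u} -> v \notin l ->
    {in v :: l, forall u, c u \subset hung x l} ->
    (exists n, embeds_seq n (hung x l)) -> exists n, embeds_seq n (hung x (v :: l)).
  move=> ch vl cl [n emb_l]; have [m emb_v] := IH v (ch v (mem_head v l)).
  exists (maxn n m).+2; apply: embeds_hung_cons => //.
    exact: embeds_mono (leq_maxl n m) emb_l.
  exact: embeds_mono (leq_maxr n m) emb_v.
have emb0 : exists n, embeds_seq n (hung x [::]).
  by exists 0; rewrite hung_nil; apply: embeds_singleton.
case lx: (lb x) => [w|]; last first.
  rewrite (@subtree_hung x [::]) // => v; apply/negP => /lb_nonleaf.
  by rewrite lx.
have xw := lb_child lx.
(* Lists grow at the head, so placing [w] at the end hangs the last-born first. *)
suff emb s : uniq (rcons s w) -> {in rcons s w, forall u, child x u} ->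
    exists n, embeds_seq n (hung x (rcons s w)).
  have mem_s v : (v \in rcons (rem w (enum (child x))) w) = child x v.
    rewrite mem_rcons inE mem_rem_uniq ?enum_uniq // !inE mem_enum.
    by case: eqVneq => [->|].
  rewrite (@subtree_hung x (rcons (rem w (enum (child x))) w)) => [|v]; last by rewrite mem_s.
  apply: emb => [|u]; last by rewrite mem_s.
  by rewrite rcons_uniq mem_rem_uniq ?enum_uniq // !inE eqxx rem_uniq // enum_uniq.
elim: s => [_ ch|v s IHs /= /andP[vs us] ch].
  apply: grow => // u; rewrite mem_seq1 => /eqP->.
  by rewrite (c_lb lx) sub0set.
apply: grow => // [u /ch xu|]; last first.
  by apply: IHs => // u us'; apply: ch; rewrite inE us' orbT.
(* Whatever a child of [x] chooses lies below the last-born [w], which is already hung. *)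
apply/subsetP => y /mem_choose[/andP[_ /eqP pu]] [w' []].
case/andP: xu => _ /eqP->; rewrite lx => [[<-]] _ wy.
by apply/mem_hung; right; exists w => //; rewrite mem_rcons mem_head.
Qed.

End TreeEmbedding.

Lemma burling_graph_injective (H : sgraph) k (f : H -> burling k) :
  1 <= k -> injective f -> (forall x y, adj (f x) (f y) = adj x y) -> burling_graph H.
Proof.
move=> k1 inj_f adj_f; exists k => //; exists (f @: setT).
have fA x : f x \in f @: setT by rewrite imset_f.
exists (fun x => exist _ (f x) (fA x)) => [|x y]; last exact: adj_f.
apply: inj_card_bij => [x y /(congr1 val)/inj_f //|].
by rewrite card_sig (card_imset _ inj_f) cardsT.
Qed.

Lemma derived_burling (H : sgraph) : derived_graph H -> burling_graph H.
Proof.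
case=> B [A [h bij_h adj_h]].
have [p rp parP] := tree_parent_function (troot B) (tree_is_tree B).
have c_branch (u v w : B) : child p (troot B) u v -> lastborn u = Some w -> v <> w ->
    choosef v = set0 \/
    exists2 z, anc p w z & choosef v = [set y | anc p w y && anc p y z].
  move=> /parP uv lu vw; have [[|w' s] [br hd] ->] := choose_branch uv lu vw.
    by left; apply/setP => y; rewrite !inE.
  move: hd br => /= <- /(branchP _ parP) /= ws; right; exists (last w' s).
    by have := mem_last w' s; rewrite (mem_child_path rp _ ws) => /andP[].
  by apply/setP => y; rewrite !in_set (mem_child_path rp _ ws).
have [n [g [inj_g adj_g _]]] := embeds_subtree rp
  (fun u w luw => (parP u w).1 (lastborn_child luw))
  (fun u v uv => lastborn_nonleaf ((parP u v).2 uv))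
  (choose_root B) (fun u w luw => choose_lastborn luw) c_branch (troot B).
have top v : v \in [set y | anc p (troot B) y] by rewrite inE (anc_root rp).
(* The sequence is indexed from 1, so [n] applications of [next] to the one-vertex graph give
   [burling n.+1]. *)
apply: (@burling_graph_injective H n.+1 (fun x => g (val (h x)))) => // x y.
  by move/(inj_g _ _ (top _) (top _))/val_inj/(bij_inj bij_h).
by rewrite adj_g // -adj_h /underlying /induced /full_arc /choose_edge orbC.
Qed.

Theorem theorem4p9 (H : sgraph) : burling_graph H <-> derived_graph H.
Proof. by split; [apply: burling_derived|apply: derived_burling]. Qed.
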